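(* Let $n\ge 2$, let $T$ be the standard maximal torus of $SO(2n)$ and $W$ its Weyl group. Then the function $V:T\to[0,\infty)$, $$V(t_\theta)=\prod_{1\le j<k\le n}\sin^2\left(\frac{\theta_k-\theta_j}{2}\right)\sin^2\left(\frac{\theta_k+\theta_j}{2}\right),$$ attains its maximum at a unique point of $T/W$; that is, the set of points of $T$ at which $V$ is maximal is a single $W$-orbit.
   Context: $T\subset SO(2n)$ is the group of block diagonal matrices $t_\theta$ consisting of $n$ blocks of size $2\times2$, the $j$-th block being rotation by the angle $\theta_j\in\mathbb R/2\pi\mathbb Z$. The Weyl group $W$ acts on $(\theta_1,\ldots,\theta_n)$ by all permutations together with all changes of an even number of signs. The positive roots of $SO(2n)$ are $\theta_k-\theta_j$ and $\theta_k+\theta_j$ for $1\le j<k\le n$. Up to a constant factor $V(t)$ is the volume of the conjugacy class of $t$. *)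

(* Defs.v *)
From HB Require Import structures.
From mathcomp Require Import all_boot all_order all_algebra all_fingroup.
From mathcomp Require Import ring.
From mathcomp Require Import all_classical all_reals all_analysis.

Set Implicit Arguments.
Unset Strict Implicit.
Unset Printing Implicit Defensive.

Import Order.TTheory GRing.Theory Num.Theory.
Local Open Scope classical_set_scope.
Local Open Scope ring_scope.

Definition rot2 (R : realType) (a : R) : 'M[R]_2 :=
  \matrix_(i < 2, j < 2)
    if i == j then cos a else if (i < j)%N then - sin a else sin a.

Lemma sum_ord2 (n : nat) : (\sum_(j < n) 2 = 2 * n)%N.
Proof. by rewrite sum_nat_const card_ord mulnC. Qed.

(* An angle vector in R^n represents its class in (R/2piZ)^n; two vectors have
   the same class iff their images under [torus_elt] coincide. *)
Definition torus_elt (R : realType) (n : nat) (theta : 'rV[R]_n) :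
    'M[R]_(2 * n) :=
  castmx (sum_ord2 n, sum_ord2 n) (\mxdiag_(j < n) rot2 (theta 0 j)).

Definition torus (R : realType) (n : nat) : set 'M[R]_(2 * n) :=
  [set torus_elt theta | theta in [set: 'rV[R]_n]].
Arguments torus R n : clear implicits.

(* A pair (s, E) stands for the permutation s combined with the sign changes
   at the positions in E. *)
Definition weyl (n : nat) : {set {perm 'I_n} * {set 'I_n}} :=
  [set w : {perm 'I_n} * {set 'I_n} | ~~ odd #|w.2|]%SET.

Definition weyl_act (R : realType) (n : nat) (w : {perm 'I_n} * {set 'I_n})
    (theta : 'rV[R]_n) : 'rV[R]_n :=
  \row_j ((-1) ^+ (j \in w.2) * theta 0 (w.1 j)).

Definition weyl_orbit (R : realType) (n : nat) (t : 'M[R]_(2 * n)) :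
    set 'M[R]_(2 * n) :=
  [set s | exists2 theta : 'rV[R]_n, torus_elt theta = t &
           exists2 w, w \in weyl n & s = torus_elt (weyl_act w theta)].

Definition vol_angle (R : realType) (n : nat) (theta : 'rV[R]_n) : R :=
  \prod_(j < n) \prod_(k < n | (j < k)%N)
    (sin ((theta 0 k - theta 0 j) / 2) ^+ 2 *
     sin ((theta 0 k + theta 0 j) / 2) ^+ 2).

(* The angles of t are picked by choice; [volE] shows that the value does not
   depend on them. Off the torus the value is irrelevant. *)
Definition vol (R : realType) (n : nat) (t : 'M[R]_(2 * n)) : R :=
  vol_angle (xget 0 [set theta : 'rV[R]_n | torus_elt theta = t]).

Lemma torus_elt_eqP (R : realType) (n : nat) (theta phi : 'rV[R]_n) :
  torus_elt theta = torus_elt phi <->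
  forall j, cos (theta 0 j) = cos (phi 0 j) /\ sin (theta 0 j) = sin (phi 0 j).
Proof.
split=> [/(can_inj (castmxK _ _)) /eq_mxdiagP e j|e].
  move: (e j) => /matrixP e2; split.
    by have := e2 0 0; rewrite !mxE.
  by have := e2 1 0; rewrite !mxE.
rewrite /torus_elt; congr (castmx _ _); apply/eq_mxdiagP => j.
by apply/matrixP => a b; rewrite !mxE; case: (e j) => -> ->.
Qed.

Lemma volE (R : realType) (n : nat) (theta : 'rV[R]_n) :
  vol (torus_elt theta) = vol_angle theta.
Proof.
rewrite /vol; set phi := xget _ _.
have /torus_elt_eqP e : torus_elt phi = torus_elt theta.
  by apply: (@xgetPex _ 0 [set v | torus_elt v = torus_elt theta]); exists theta.
have sinM (a b : R) : sin ((a - b) / 2) * sin ((a + b) / 2) =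
    (cos b - cos a) / 2.
  have eb : b = (a + b) / 2 - (a - b) / 2 by field.
  have ea : a = (a + b) / 2 + (a - b) / 2 by field.
  by rewrite [in cos b]eb [in cos a]ea cosB cosD; field.
apply: eq_bigr => j _; apply: eq_bigr => k _.
by rewrite -!exprMn !sinM; case: (e j) => -> _; case: (e k) => -> _.
Qed.

Lemma vol_ge0 (R : realType) (n : nat) (t : 'M[R]_(2 * n)) : 0 <= vol t.
Proof.
by apply: prodr_ge0 => j _; apply: prodr_ge0 => k _; rewrite mulr_ge0 ?sqr_ge0.
Qed.

Lemma weyl_orbitE (R : realType) (n : nat) (theta : 'rV[R]_n) :
  weyl_orbit (torus_elt theta) =
  [set torus_elt (weyl_act w theta) | w in [set w | w \in weyl n]].
Proof.
apply/seteqP; split=> s; last by case=> w ww <-; exists theta => //; exists w.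
case=> phi /torus_elt_eqP e [w ww ->]; exists w => //.
apply/torus_elt_eqP => j; rewrite !mxE; case: (e (w.1 j)) => c d.
by case: (j \in w.2); rewrite ?expr1 ?expr0 ?mulN1r ?mul1r ?cosN ?sinN ?c ?d.
Qed.

(* Main.v *)
(** With [x_j = cos theta_j], [V] is the product of the [((x_k - x_j) / 2)^2],
    so its maxima are the Fekete points of [[-1, 1]]. The logarithm of this
    product is concave on the chamber of increasing [x], strictly so modulo
    translations, hence the sorted maximizer is unique: a translation is
    excluded because a maximizer must touch the boundary of the cube. Finally,
    a coordinate [x_j = 1] or [x_j = -1] has [sin theta_j = 0], and flipping the
    sign of that angle repairs the parity of the number of sign changes. *)
Require Import Defs.
From mathcomp Require Import all_boot all_order all_algebra all_fingroup.
From mathcomp Require Import ring lra.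
From mathcomp Require Import all_classical all_reals all_analysis.
Import Order.TTheory GRing.Theory Num.Theory.
Import numFieldNormedType.Exports.
Set Implicit Arguments.
Unset Strict Implicit.
Unset Printing Implicit Defensive.

Local Open Scope classical_set_scope.
Local Open Scope ring_scope.

(** Sorting the tuple of values permutes it; that permutation is the witness. *)
Lemma exists_sorting_perm {d : Order.disp_t} {T : orderType d} (n : nat)
    (f : 'I_n -> T) :
  exists s : {perm 'I_n}, {homo f \o s : i j / (i <= j)%N >-> (i <= j)%O}.
Proof.
have /tuple_permP[s es] :
    perm_eq (sort <=%O [tuple f i | i < n]) [tuple f i | i < n].
  by rewrite perm_sort.
exists s => i j ij /=.
have nthE (k : 'I_n) :
    nth (f i) (sort <=%O [tuple f i | i < n]) k = f (s k).
  by rewrite es -tnth_nth !tnth_mktuple.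
rewrite -!nthE; apply: le_sorted_leq_nth => //.
- by rewrite inE size_sort size_tuple.
- by rewrite inE size_sort size_tuple.
Qed.

(** * Fekete configurations in the cube *)

Definition cube (R : realType) (n : nat) : set 'rV[R]_n :=
  [set x | forall j, `|x 0 j| <= 1].
Arguments cube R n : clear implicits.

(* The factors [1/2] make this equal to [vol_angle] after [x_j = cos theta_j]. *)
Definition sep_prod (R : realType) (n : nat) (x : 'rV[R]_n) : R :=
  \prod_(p : 'I_n * 'I_n | p.1 != p.2) (`|x 0 p.1 - x 0 p.2| / 2).

Definition fekete (R : realType) (n : nat) (x : 'rV[R]_n) : Prop :=
  cube R n x /\ forall y, cube R n y -> sep_prod y <= sep_prod x.

Section FeketePoints.
Variables (R : realType) (n : nat).
Implicit Types (x y : 'rV[R]_n) (s : {perm 'I_n}).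

Lemma sep_prod_ge0 x : 0 <= sep_prod x.
Proof. by apply: prodr_ge0 => p _; rewrite divr_ge0. Qed.

Lemma sep_prod_perm s x : sep_prod (col_perm s x) = sep_prod x.
Proof.
rewrite /sep_prod [RHS](reindex (fun p => (s p.1, s p.2))) /=.
  by apply: eq_big => [[i j]|[i j] _]; rewrite /= ?(inj_eq perm_inj)// !mxE.
exists (fun p => (s^-1%g p.1, s^-1%g p.2)) => -[i j] _ /=.
  by rewrite !permK.
by rewrite !permKV.
Qed.

Lemma sep_prod_scale c x : 0 <= c ->
  sep_prod (c *: x) = c ^+ #|[pred p : 'I_n * 'I_n | p.1 != p.2]| * sep_prod x.
Proof.
move=> c0; rewrite /sep_prod -prodr_const -big_split /=.
apply: eq_bigr => p _.
by rewrite !mxE -mulrBr normrM (ger0_norm c0) mulrA.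
Qed.

Lemma fekete_perm s x : fekete x -> fekete (col_perm s x).
Proof.
move=> [cx mx]; split=> [j|y cy]; first by rewrite mxE.
by rewrite sep_prod_perm; exact: mx.
Qed.

Lemma continuous_sep_prod : continuous (@sep_prod R n).
Proof.
apply: continuous_big => [|p _ x]; first exact: mul_continuous.
apply: (@cvgM _ _ (nbhs x)); last exact: cvg_cst.
apply: (@cvg_norm _ _ _ (nbhs x)).
by apply: (@cvgB _ _ _ (nbhs x)); exact: coord_continuous.
Qed.

Lemma exists_fekete : exists x : 'rV[R]_n, fekete x.
Proof.
have [|||x /set_mem cx mx] := @EVT_max_rV R n (@sep_prod R n) (cube R n).
- by exists 0 => j; rewrite mxE normr0.
- have := @rV_compact R n _ (fun=> @segment_compact R (-1) 1).
  congr compact; apply/seteqP; split=> x /= cx j; have := cx j;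
    by rewrite /= in_itv /= ler_norml.
- exact: continuous_subspaceT continuous_sep_prod.
by exists x; split=> // y cy; apply: mx; exact/mem_set.
Qed.

(** The distinct points [j / n] of the cube already give a positive product. *)
Lemma fekete_gt0 x : fekete x -> 0 < sep_prod x.
Proof.
move=> [_ mx]; pose y : 'rV[R]_n := \row_j (j%:R / n%:R).
have /mx : cube R n y.
  move=> j; rewrite mxE normf_div !normr_nat ler_pdivrMr ?mul1r ?ler_nat 1?ltnW//.
  by rewrite ltr0n (leq_ltn_trans _ (ltn_ord j)).
apply: lt_le_trans.
apply: prodr_gt0 => -[i j] /= ij.
rewrite divr_gt0// normr_gt0 !mxE -mulrBl mulf_neq0//.
  by rewrite subr_eq0 eqr_nat.
by rewrite invr_eq0 pnatr_eq0 -lt0n (leq_ltn_trans _ (ltn_ord j)).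
Qed.

(* Otherwise dilating [x] until it touches the boundary increases the product. *)
Lemma fekete_boundary x : (2 <= n)%N -> fekete x -> exists j, `|x 0 j| = 1.
Proof.
move=> n2 fx; have [cx mx] := fx; have x_gt0 := fekete_gt0 fx.
pose i0 : 'I_n := Ordinal (ltnW n2); pose i1 : 'I_n := Ordinal n2.
have [j _ jmax] := @arg_maxP _ _ _ i0 xpredT (fun j => `|x 0 j|) isT.
exists j; apply/eqP; rewrite eq_le cx /= leNgt; apply/negP => xj1.
have xj0 : 0 < `|x 0 j|.
  rewrite lt_neqAle normr_ge0 andbT eq_sym; apply/eqP => xj0.
  have x0 k : x 0 k = 0.
    by apply/eqP; rewrite -normr_le0 -xj0; exact: jmax.
  move: x_gt0; rewrite /sep_prod (bigD1 (i0, i1))//=.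
  by rewrite !x0 subrr normr0 mul0r mul0r ltxx.
have /mx : cube R n (`|x 0 j|^-1 *: x).
  move=> k; rewrite mxE normrM ger0_norm ?invr_ge0// mulrC ler_pdivrMr// mul1r.
  exact: jmax.
rewrite sep_prod_scale ?invr_ge0// ger_pMl// leNgt expr_gt1 ?invr_ge0//.
  by rewrite invf_gt1// xj1.
(* The pair [(i0, i1)] makes the exponent nonzero, so the increase is strict. *)
by rewrite (cardD1 (i0, i1)) inE.
Qed.

(* AM-GM on each factor shows that the midpoint [z] is again optimal and that
   [x - y] is constant; a coordinate of [z] equal to [1] or [-1] forces the
   constant to be [0]. *)
Lemma sorted_fekete_unique x y : (2 <= n)%N ->
  {homo x 0 : i j / (i <= j)%N >-> i <= j} ->
  {homo y 0 : i j / (i <= j)%N >-> i <= j} ->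
  fekete x -> fekete y -> x = y.
Proof.
move=> n2 sx sy fx fy; have [cx mx] := fx; have [cy my] := fy.
pose z := 2^-1 *: (x + y).
have cz : cube R n z.
  move=> j; rewrite !mxE normrM ger0_norm ?invr_ge0// mulrC ler_pdivrMr//.
  by rewrite mul1r (le_trans (ler_normD _ _))// (lerD (cx j) (cy j)).
have exy : sep_prod x = sep_prod y by apply/le_anti; rewrite mx ?my.
have amgm p : (`|x 0 p.1 - x 0 p.2| / 2) * (`|y 0 p.1 - y 0 p.2| / 2) <=
    (`|z 0 p.1 - z 0 p.2| / 2) ^+ 2
    ?= iff (x 0 p.1 - x 0 p.2 == y 0 p.1 - y 0 p.2).
  set a := x 0 p.1 - x 0 p.2; set b := y 0 p.1 - y 0 p.2.
  have -> : z 0 p.1 - z 0 p.2 = 2^-1 * (a + b) by rewrite !mxE /a /b; ring.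
  have -> : (`|2^-1 * (a + b)| / 2) ^+ 2 = ((a / 2 + b / 2) / 2) ^+ 2.
    by rewrite exprMn -normrX ger0_norm ?sqr_ge0//; field.
  have -> : `|a| / 2 * (`|b| / 2) = (a / 2) * (b / 2).
    (* Both rows are sorted, so [a] and [b] never have opposite signs. *)
    suff ab : 0 <= a * b.
      have -> : `|a| / 2 * (`|b| / 2) = `|a * b| / 4 by rewrite normrM; field.
      by rewrite ger0_norm//; field.
    rewrite /a /b; have [le12|/ltnW le21] := leqP p.1 p.2.
      by rewrite mulr_le0 ?subr_le0 ?sx ?sy.
    by rewrite mulr_ge0 ?subr_ge0 ?sx ?sy.
  have -> : (a == b) = (a / 2 == b / 2).
    by rewrite (inj_eq (mulIf _))// invr_eq0.
  exact: leif_AGM2.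
(* Unless the larger product vanishes, equality of the products forces equality in every factor. *)
have prod_amgm := leif_pprod (P := fun p : 'I_n * 'I_n => p.1 != p.2)
  (fun p _ => mulr_ge0 (divr_ge0 (normr_ge0 _) (ler0n _ 2))
                       (divr_ge0 (normr_ge0 _) (ler0n _ 2)))
  (fun p _ => amgm p).
move: prod_amgm => /=; rewrite big_split prodrXl /=.
rewrite -!/(sep_prod _) -exy -expr2 => prod_amgm.
have ez : sep_prod z = sep_prod x.
  apply/le_anti; rewrite mx//=.
  by rewrite -(@ler_pXn2r _ 2)// ?nnegrE ?sep_prod_ge0// prod_amgm.1.
have fz : fekete z by split=> // w cw; rewrite ez; exact: mx.
have [j zj] := fekete_boundary n2 fz.
(* An endpoint of [[-1, 1]] is the midpoint of two points of that segment only if both equal it. *)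
have xyj : x 0 j = y 0 j.
  move: zj (cx j) (cy j); rewrite !mxE !ler_norml.
  by case: (ger0P (2^-1 * (x 0 j + y 0 j))) => _; lra.
move: prod_amgm.2; rewrite ez eqxx expf_eq0 /= gt_eqF ?fekete_gt0//=.
move=> /esym/forallP e; apply/rowP => k.
have [->//|kj] := eqVneq k j.
by have := e (k, j); rewrite /= kj /= xyj => /eqP/addIr.
Qed.

(** Sorting both configurations reduces this to the increasing case. *)
Lemma fekete_unique x y : (2 <= n)%N -> fekete x -> fekete y ->
  exists s, y = col_perm s x.
Proof.
move=> n2 fx fy.
have [s sx] := exists_sorting_perm (x 0).
have [r ry] := exists_sorting_perm (y 0).
have e : col_perm s x = col_perm r y.
  apply: sorted_fekete_unique; rewrite //; last exact: fekete_perm.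
  - by move=> i j ij; rewrite !mxE; exact: sx.
  - by move=> i j ij; rewrite !mxE; exact: ry.
  - exact: fekete_perm.
exists (r^-1 * s)%g.
by rewrite col_permM e -col_permM mulVg col_perm1.
Qed.

(** Each factor comes from [sin ((a - b) / 2) * sin ((a + b) / 2) = (cos b - cos a) / 2], squared
    because [sep_prod] runs over ordered pairs. *)
Lemma vol_angle_sep_prod (theta : 'rV[R]_n) :
  vol_angle theta = sep_prod (map_mx cos theta).
Proof.
set x := map_mx cos theta; rewrite /sep_prod.
rewrite (bigID (fun p : 'I_n * 'I_n => (p.1 < p.2)%N)) /=.
rewrite [X in _ * X](reindex (fun p : 'I_n * 'I_n => (p.2, p.1))) /=; last first.
  by exists (fun p => (p.2, p.1)) => -[].
have ltE (p : 'I_n * 'I_n) : (p.1 != p.2) && (p.1 < p.2)%N = (p.1 < p.2)%N.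
  by rewrite andbC andb_idr// => /ltn_eqF /negbT.
have gtE (p : 'I_n * 'I_n) : (p.2 != p.1) && ~~ (p.2 < p.1)%N = (p.1 < p.2)%N.
  by rewrite -leqNgt [RHS]ltn_neqAle eq_sym.
rewrite (eq_bigl _ _ ltE) (eq_bigl _ _ gtE) -big_split /= /vol_angle.
rewrite pair_big_dep /=; apply: eq_bigr => -[j k] _ /=.
rewrite (distrC (x 0 k)) -expr2 exprMn -normrX ger0_norm ?sqr_ge0// !mxE.
set a := theta 0 k; set b := theta 0 j.
have eb : b = (a + b) / 2 - (a - b) / 2 by field.
have ea : a = (a + b) / 2 + (a - b) / 2 by field.
by rewrite -!exprMn [in cos b]eb [in cos a]ea cosB cosD; field.
Qed.

End FeketePoints.

(** * From cosines back to the torus and its Weyl orbits *)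

Section TorusMaxima.
Variables (R : realType) (n : nat).
Implicit Types (theta phi : 'rV[R]_n).

Lemma cube_map_cos theta : cube R n (map_mx cos theta).
Proof. by move=> j; rewrite mxE ler_norml cos_geN1 cos_le1. Qed.

Lemma map_acosK (x : 'rV[R]_n) : cube R n x -> map_mx cos (map_mx acos x) = x.
Proof.
by move=> cx; apply/rowP => j; rewrite !mxE acosK// in_itv /= -ler_norml.
Qed.

(** [acos] is a section of [cos] on [[-1, 1]], so the cosines of angle vectors fill the whole
    cube. *)
Lemma vol_maxE theta :
  (forall s, torus R n s -> vol s <= vol (torus_elt theta)) <->
  fekete (map_mx cos theta).
Proof.
split=> [m|[_ m] _ [phi _ <-]]; last first.
  by rewrite !volE !vol_angle_sep_prod; apply/m/cube_map_cos.
split=> [|x cx]; first exact: cube_map_cos.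
rewrite -(map_acosK cx) -!vol_angle_sep_prod -!volE.
by apply: m; exists (map_mx acos x).
Qed.

(** Cosine is even, so only the permutation survives. *)
Lemma map_cos_weyl_act w theta :
  map_mx cos (weyl_act w theta) = col_perm w.1 (map_mx cos theta).
Proof.
apply/rowP => j; rewrite !mxE.
by case: (j \in w.2); rewrite ?expr1 ?expr0 ?mulN1r ?mul1r ?cosN.
Qed.

(* A sign change at [j] with [sin theta_j = 0] acts trivially, so the parity
   condition on the sign changes is no restriction. *)
Lemma torus_elt_weyl theta phi s j0 :
  map_mx cos phi = col_perm s (map_mx cos theta) -> `|cos (phi 0 j0)| = 1 ->
  exists2 w, w \in weyl n & torus_elt phi = torus_elt (weyl_act w theta).
Proof.
move=> /rowP e cj0.
have cE j : cos (phi 0 j) = cos (theta 0 (s j)) by have := e j; rewrite !mxE.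
have sE j : (sin (phi 0 j) == sin (theta 0 (s j))) ||
            (sin (phi 0 j) == - sin (theta 0 (s j))).
  by rewrite -eqf_sqr !sin2cos2 cE.
have sin0 (a : R) : `|cos a| = 1 -> sin a = 0.
  move=> ca; apply/eqP; rewrite -sqrf_eq0 sin2cos2 -real_normK ?num_real//.
  by rewrite ca expr1n subrr.
have sphi0 : sin (phi 0 j0) = 0 by exact: sin0.
have stheta0 : sin (theta 0 (s j0)) = 0 by apply: sin0; rewrite -cE.
(* [E] collects the forced sign changes; [j0] is not among them, so adding it corrects an odd
   parity. *)
pose E := [set j | sin (phi 0 j) != sin (theta 0 (s j))]%SET.
pose E' := if odd #|E| then (j0 |: E)%SET else E.
exists (s, E').
  rewrite inE /= /E'; case: ifPn => // oE.
  by rewrite cardsU1 inE sphi0 stheta0 eqxx /= oE.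
apply/torus_elt_eqP => j; rewrite mxE /=.
have [->|jj0] := eqVneq j j0.
  rewrite sphi0 cE; case: (j0 \in E');
    by rewrite ?expr1 ?expr0 ?mulN1r ?mul1r ?cosN ?sinN stheta0 ?oppr0.
have -> : (j \in E') = (sin (phi 0 j) != sin (theta 0 (s j))).
  by rewrite /E'; case: ifP; rewrite !inE ?(negPf jj0).
case: eqVneq (sE j) => [-> _|_ /= /eqP ->].
  by rewrite expr0 mul1r cE.
by rewrite expr1 mulN1r cosN sinN cE.
Qed.

End TorusMaxima.

Theorem corollary4p8 (R : realType) (n : nat) (hn : (2 <= n)%N) :
  exists2 t0 : 'M[R]_(2 * n), torus R n t0 &
    [set t | torus R n t /\ forall s, torus R n s -> vol s <= vol t] =
    weyl_orbit t0.
Proof.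
have [x fx] := exists_fekete R n.
pose theta : 'rV[R]_n := map_mx acos x.
have cos_theta : map_mx cos theta = x by apply: map_acosK; case: fx.
exists (torus_elt theta); first by exists theta.
rewrite weyl_orbitE; apply/seteqP; split=> [_ [[phi _ <-] /vol_maxE fphi]|_ [w _ <-]].
  (* The maximizer also touches the boundary of the cube, which provides the index where the sign is
     free. *)
  have [s es] := fekete_unique hn fx fphi.
  have [j] := fekete_boundary hn fphi; rewrite mxE => cj.
  rewrite -cos_theta in es.
  by have [w ww ->] := torus_elt_weyl es cj; exists w.
split; first by exists (weyl_act w theta).
by apply/vol_maxE; rewrite map_cos_weyl_act cos_theta; exact: fekete_perm.
Qed.
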